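(* Every snark $G$ with colouring defect $\mathrm{df}(G)=3$ has a cycle cover of length at most $\frac{4}{3}m+1$, where $m=|E(G)|$.
   Context: Graphs are finite; loops and multiple edges are allowed. A snark is a $2$-connected cubic graph with no proper $3$-edge-colouring. A $3$-array of a bridgeless cubic graph is a set of three perfect matchings; an edge is uncovered if it belongs to none of them; the colouring defect $\mathrm{df}(G)$ is the minimum number of uncovered edges over all $3$-arrays. A cycle is a subgraph in which every vertex has even degree; its length is its number of edges. A cycle cover of $G$ is a collection of cycles such that every edge of $G$ belongs to at least one of them; its length is the sum of the lengths of its cycles. *)

(* Defs.v *)
(* Finite multigraphs (loops and parallel edges allowed):
   a finite vertex type V, a finite edge type E, and two endpoint maps
   s t : E -> V (a loop is an edge e with s e = t e). *)
From mathcomp Require Import all_boot.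
Set Implicit Arguments. Unset Strict Implicit. Unset Printing Implicit Defensive.

Section Graphs.
Variables (V E : finType) (s t : E -> V).

Definition inc (e : E) (v : V) : nat := (s e == v) + (t e == v).

Definition deg (F : {set E}) (v : V) : nat := \sum_(e in F) inc e v.

Definition cubic : Prop := forall v, deg [set: E] v = 3.

Definition adj : rel V :=
  fun u v => [exists e : E, ((s e == u) && (t e == v)) || ((s e == v) && (t e == u))].

Definition adj_avoid (w : V) : rel V := fun u v => [&& u != w, v != w & adj u v].

Definition connected_graph : Prop := forall u v, connect adj u v.

Definition two_connected : Prop :=
  connected_graph /\
  forall w u v, u != w -> v != w -> connect (adj_avoid w) u v.

(* proper 3-edge-colouring: each colour class has degree <= 1 at each vertex
   (so a loop can never be properly coloured) *)
Definition three_edge_colourable : Prop :=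
  exists c : {ffun E -> 'I_3},
    forall (v : V) (i : 'I_3), deg [set e | c e == i] v <= 1.

Definition snark : Prop :=
  two_connected /\ cubic /\ ~ three_edge_colourable.

Definition perfect_matching (M : {set E}) : bool := [forall v, deg M v == 1].

Definition three_array (A : {set E} * {set E} * {set E}) : bool :=
  [&& perfect_matching A.1.1, perfect_matching A.1.2 & perfect_matching A.2].

Definition uncovered (A : {set E} * {set E} * {set E}) : {set E} :=
  ~: (A.1.1 :|: A.1.2 :|: A.2).

(* colouring defect: minimum number of uncovered edges over all 3-arrays
   (the default #|E| is only used if there is no 3-array at all) *)
Definition colouring_defect : nat :=
  \big[minn/#|E|]_(A : {set E} * {set E} * {set E} | three_array A) #|uncovered A|.

(* a cycle: a subgraph in which every vertex has even degree (given by its edge set) *)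
Definition even_subgraph (C : {set E}) : bool := [forall v, ~~ odd (deg C v)].

Definition cycle_cover (cs : seq {set E}) : Prop :=
  all even_subgraph cs /\ forall e : E, has (fun C : {set E} => e \in C) cs.

Definition cover_length (cs : seq {set E}) : nat := \sum_(C <- cs) #|C|.

End Graphs.

(* Main.v *)
Require Import Defs.
From mathcomp Require Import all_boot.
From mathcomp Require Import zify.

(* Minimality forces the three uncovered edges of an optimal array to alternate, along a
   hexagon, with the three edges lying in two of its matchings.  The edges outside the hexagon
   are then 3-coloured, the six pendant colours being 0,0,1,1,2,2 in cyclic order.  If some
   3-colouring of the outside avoids a colour on all pendant edges, that colour class completes
   to a fourth perfect matching and yields a cover of length 4m/3.  Otherwise a Kempe chain
   between pendant edges always joins two different colours, and at most three chain switches
   lead either to a pendant pattern extending to a 3-edge-colouring of the whole graph, or to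
   one where the 01-chains and the 02-chains can be closed up inside the hexagon so as to cover
   it with 9 edges in total; the latter cover has length 4m/3 + 1. *)

Set Implicit Arguments.
Unset Strict Implicit.
Unset Printing Implicit Defensive.

Lemma card_setU_le (T : finType) (A B : {set T}) : #|A :|: B| <= #|A| + #|B|.
Proof. exact: leq_card_setU. Qed.

(** * Degrees, handshaking and path components in multigraphs *)

Section Multigraph.
Variables (V E : finType) (s t : E -> V).
Implicit Types (F P Q : {set E}) (e : E) (u w x y z : V).

Local Notation deg := (deg s t).
Local Notation inc := (inc s t).
Local Notation even_subgraph := (even_subgraph s t).

Definition joins e x y := forall z, inc e z = (z == x) + (z == y).

Lemma joinsC e x y : joins e x y -> joins e y x.
Proof. by move=> J z; rewrite J addnC. Qed.

Lemma joins_ends e : joins e (s e) (t e).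
Proof. by move=> z; rewrite /Defs.inc !(eq_sym z). Qed.

Lemma inc_joins e x : 0 < inc e x -> exists y, joins e x y.
Proof.
rewrite /Defs.inc; case: (s e =P x) => [<- _|_].
  by exists (t e) => z; rewrite /Defs.inc !(eq_sym z).
case: (t e =P x) => [<- _|_] //.
by exists (s e) => z; rewrite /Defs.inc !(eq_sym z) addnC.
Qed.

Lemma joins_end e x y z : joins e x y -> 0 < inc e z -> z = x \/ z = y.
Proof. by move=> ->; case: eqP => [->|_]; [left|case: eqP => [->|_] //; right]. Qed.

Lemma joins_gt0 e x y : joins e x y -> 0 < inc e x.
Proof. by move=> ->; rewrite eqxx. Qed.

Lemma joins_other e x y z : joins e x y -> joins e x z -> y = z.
Proof.
by move=> Jy Jz; have := Jy z; rewrite Jz eqxx => /addnI; case: (z =P y).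
Qed.

Lemma deg_mono F P x : F \subset P -> deg F x <= deg P x.
Proof.
move=> FP; rewrite /Defs.deg [leqRHS](big_setID F) /= (setIidPr FP).
exact: leq_addr.
Qed.

Lemma deg_inc F e x : e \in F -> inc e x <= deg F x.
Proof. by move=> eF; rewrite /Defs.deg (big_setD1 e) //= leq_addr. Qed.

Lemma deg_setD1 F e x : e \in F -> deg F x = inc e x + deg (F :\ e) x.
Proof. by move=> eF; rewrite /Defs.deg (big_setD1 e). Qed.

Lemma deg0 x : deg set0 x = 0.
Proof. by rewrite /Defs.deg big_set0. Qed.

Lemma deg1 e x : deg [set e] x = inc e x.
Proof. by rewrite /Defs.deg big_set1. Qed.

Lemma deg_setID F P x : deg F x = deg (F :&: P) x + deg (F :\: P) x.
Proof. by rewrite /Defs.deg (big_setID P). Qed.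

Lemma deg_disjointU F P x : [disjoint F & P] -> deg (F :|: P) x = deg F x + deg P x.
Proof. by move=> FP; rewrite /Defs.deg -bigU //=; apply: eq_bigl => e; rewrite inE. Qed.

Lemma deg_gt0 F x : 0 < deg F x -> exists e y, e \in F /\ joins e x y.
Proof.
rewrite /Defs.deg lt0n sum_nat_eq0 => /forall_inPn[e eF ne].
by have [|y J] := @inc_joins e x; [rewrite lt0n|exists e, y].
Qed.

Lemma deg_le1_inj F x e1 e2 : deg F x <= 1 -> e1 \in F -> e2 \in F ->
  0 < inc e1 x -> 0 < inc e2 x -> e1 = e2.
Proof.
move=> F1 e1F e2F i1 i2; case: (eqVneq e2 e1) => // ne.
move: F1; rewrite (deg_setD1 x e1F).
have := @deg_inc (F :\ e1) e2 x; rewrite !inE ne e2F => /(_ isT); lia.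
Qed.

Lemma handshake F : \sum_x deg F x = 2 * #|F|.
Proof.
rewrite /Defs.deg exchange_big /= mulnC -sum_nat_const.
apply: eq_bigr => e _; rewrite /Defs.inc big_split /=.
by rewrite -!(big_mkcond (fun x => _ == x)) /= !(big_pred1 _ (fun x => eq_sym _ _)).
Qed.

Lemma card_edges : cubic s t -> 2 * #|E| = 3 * #|V|.
Proof.
by move=> cubicG; rewrite -cardsT -handshake (eq_bigr (fun _ => 3)) ?sum_nat_const 1?mulnC.
Qed.

Lemma odd_deg_symdiff F P x :
  odd (deg ((F :\: P) :|: (P :\: F)) x) = odd (deg F x) (+) odd (deg P x).
Proof.
rewrite deg_disjointU; last first.
  by rewrite -setI_eq0; apply/eqP/setP=> e; rewrite !inE; case: (e \in F); case: (e \in P).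
rewrite (deg_setID F P) (deg_setID P F) (setIC P F) !oddD.
by case: odd; case: odd; case: odd.
Qed.

(* An alternating description of a path component without mentioning paths:
   [P] is a union of components of [F] whose only odd vertices are [u] and [w]. *)
Definition chain F P u w :=
  [/\ P \subset F, forall x, odd (deg P x) = (x == u) || (x == w) &
      forall x, deg P x = 0 \/ deg P x = deg F x].

(** Induction on the number of edges: delete the only edge [e] at [u]. Its other end [y] either had
    degree 1, and [e] is the whole chain, or has degree 1 now, and the walk goes on from [y]. It
    cannot return to [u], which has become isolated. *)
Lemma chain_exists F u : (forall x, deg F x <= 2) -> deg F u = 1 ->
  exists P w, [/\ w != u, deg F w = 1 & chain F P u w].
Proof.
have [n] := ubnP #|F|; elim: n F u => // n IH F u Fn F2 Fu.
have [e [y [eF J]]] : exists e y, e \in F /\ joins e u y by apply: deg_gt0; rewrite Fu.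
have yu : y != u.
  by apply/eqP=> yu; have := deg_inc u eF; rewrite J yu Fu eqxx.
have degF x := deg_setD1 x eF.
have Jy : inc e y = 1 by rewrite J eqxx (negPf yu).
have Ju : inc e u = 1 by rewrite J eqxx eq_sym (negPf yu).
case: (eqVneq (deg F y) 1) => [Fy|Fy].
  exists [set e], y; split=> //; split=> [|x|x].
  - by rewrite sub1set.
  - by rewrite deg1 J; case: (x =P u) => [->|_]; [rewrite eq_sym (negPf yu)|case: eqP].
  rewrite deg1 J; case: (x =P u) => [->|_]; first by rewrite Fu eq_sym (negPf yu); right.
  by case: (x =P y) => [->|_]; [right|left].
have F'y : deg (F :\ e) y = 1 by have := F2 y; have := degF y; lia.
have F'u : deg (F :\ e) u = 0 by have := degF u; lia.
have [|x|P [w [wy F'w [PF Podd Pcl]]]] := IH (F :\ e) y _ _ F'y.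
- by move: Fn; rewrite (cardsD1 e) eF; lia.
- by have := F2 x; have := degF x; lia.
have wu : w != u by apply/eqP=> wu; move: F'w; rewrite wu F'u.
have eP : e \notin P by apply/negP=> /(subsetP PF); rewrite !inE eqxx.
have degP x : deg (e |: P) x = inc e x + deg P x.
  by rewrite (@deg_setD1 _ e) ?setU11 // setU1K.
exists (e |: P), w; split=> //; first by rewrite degF F'w J (negPf wu) (negPf wy).
split=> [|x|x].
- by rewrite subUset sub1set eF (subset_trans PF) // subsetDl.
- rewrite degP oddD Podd J.
  case: (x =P u) => [->|_]; first by rewrite eq_sym (negPf yu) eq_sym (negPf wu).
  case: (x =P y) => [->|_] //; by rewrite eq_sym (negPf wy).
(* Suppose the shorter chain misses [x]. If [x] is [u], no edge other than [e] is left there; [x]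
   cannot be [y], whose degree in [P] is odd. *)
rewrite degP degF; case: (Pcl x) => Px; last by right; rewrite Px.
rewrite Px addn0 J; case: (x =P u) => [->|_]; first by rewrite F'u addn0; right.
case: (x =P y) => [xy|_]; last by left.
by have := Podd x; rewrite Px xy eqxx.
Qed.

End Multigraph.

(** * Colourings of the edges outside a hexagon *)

Section Hexagon.
Variables (V E : finType) (s t : E -> V) (v0 : V) (e0 : E) (vs : seq V) (hs : seq E).
Implicit Types (F P Q : {set E}) (e : E) (x : V) (c : E -> nat) (f X Y : seq nat).
Implicit Types i j k l : nat.

Local Notation deg := (deg s t).
Local Notation inc := (inc s t).
Local Notation even_subgraph := (even_subgraph s t).
Local Notation joins := (joins s t).
Local Notation chain := (chain s t).
Local Notation vx := (nth v0 vs).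
Local Notation hx := (nth e0 hs).

Hypothesis size_vs : size vs = 6.
Hypothesis size_hs : size hs = 6.
Hypothesis uniq_vs : uniq vs.
Hypothesis uniq_hs : uniq hs.
Hypothesis hexagon : forall k, k < 6 -> joins (hx k) (vx k) (vx (k.+1 %% 6)).
Hypothesis cubicG : cubic s t.

Lemma vsP x : x \in vs -> exists2 k, k < 6 & x = vx k.
Proof. by move=> xvs; exists (index x vs); rewrite ?nth_index // -size_vs index_mem. Qed.

Lemma vx_mem k : k < 6 -> vx k \in vs.
Proof. by move=> k6; rewrite mem_nth ?size_vs. Qed.

Lemma vx_eq k l : k < 6 -> l < 6 -> (vx k == vx l) = (k == l).
Proof. by move=> k6 l6; rewrite nth_uniq ?size_vs. Qed.

(* [f] lists the colours of the edges outside the hexagon at its six vertices *)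
Definition pattern_deg f i x : nat :=
  if x \in vs then nth 3 f (index x vs) == i else true.

Definition outside : {set E} := [set e | e \notin hs].
Definition colour_class c i := [set e in outside | c e == i].
Definition kempe_graph c i j := [set e in outside | (c e == i) || (c e == j)].

Definition colouring c f :=
  (forall e, e \in outside -> c e < 3) /\
  (forall i x, i < 3 -> deg (colour_class c i) x = pattern_deg f i x).

Lemma pattern_deg_vx f i k : k < 6 -> pattern_deg f i (vx k) = (nth 3 f k == i).
Proof. by move=> k6; rewrite /pattern_deg vx_mem // index_uniq ?size_vs. Qed.

(** Each vertex off the hexagon contributes 1, and the hexagon vertices contribute the occurrences
    of [i] in [f]. With handshaking this fixes the size of every colour class. *)
Lemma sum_pattern_deg f i : size f = 6 ->
  \sum_x pattern_deg f i x + 6 = #|V| + count_mem i f.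
Proof.
move=> f6; rewrite (bigID (mem vs)) /= -big_uniq // (big_nth v0) size_vs.
rewrite [X in _ + X + _](eq_bigr (fun _ => 1)); last first.
  by move=> x /negPf xvs; rewrite /pattern_deg xvs.
rewrite sum1_card -(cardC (mem vs)) (card_uniqP _) // size_vs.
suff -> : \sum_(0 <= k < 6) pattern_deg f i (vx k) = count_mem i f.
  by rewrite [RHS]addnC addnCA addnC addnA.
rewrite -sum1_count [RHS]big_mkcond [RHS](big_nth 3) f6.
by apply: eq_big_nat => k /andP[_ k6]; rewrite pattern_deg_vx //; case: eqP.
Qed.

Lemma card_colour_class c f i : colouring c f -> size f = 6 -> i < 3 ->
  2 * #|colour_class c i| + 6 = #|V| + count_mem i f.
Proof.
move=> [_ cf] f6 i3; rewrite -sum_pattern_deg // -(handshake s t).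
by congr (_ + _); apply: eq_bigr => x _; rewrite cf.
Qed.

Lemma kempe_graphU c i j : kempe_graph c i j = colour_class c i :|: colour_class c j.
Proof. by apply/setP=> e; rewrite !inE andb_orr. Qed.

Lemma colour_class_disjoint c i j : i != j ->
  [disjoint colour_class c i & colour_class c j].
Proof.
move=> ij; rewrite -setI_eq0; apply/eqP/setP=> e; rewrite !inE.
by case: (c e =P i) => [->|]; rewrite ?andbF // (negPf ij) !andbF.
Qed.

Lemma deg_kempe_graph c f i j x : colouring c f -> i < 3 -> j < 3 -> i != j ->
  deg (kempe_graph c i j) x = pattern_deg f i x + pattern_deg f j x.
Proof.
move=> [_ cf] i3 j3 ij.
by rewrite kempe_graphU deg_disjointU ?colour_class_disjoint // !cf.
Qed.

Lemma deg_kempe_graph_vx c f i j k : colouring c f -> i < 3 -> j < 3 -> i != j ->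
  k < 6 -> deg (kempe_graph c i j) (vx k) = (nth 3 f k \in [:: i; j]).
Proof.
move=> cf i3 j3 ij k6; rewrite (deg_kempe_graph _ cf) // !pattern_deg_vx // !inE.
by case: (nth 3 f k =P i) => [->|_]; rewrite ?(negPf ij).
Qed.

Lemma deg_kempe_graph_out c f i j x : colouring c f -> i < 3 -> j < 3 -> i != j ->
  x \notin vs -> deg (kempe_graph c i j) x = 2.
Proof.
move=> cf i3 j3 ij xvs.
by rewrite (deg_kempe_graph _ cf) // /pattern_deg (negPf xvs).
Qed.

Lemma deg_kempe_graph1 c f i j x : colouring c f -> i < 3 -> j < 3 -> i != j ->
  deg (kempe_graph c i j) x = 1 ->
  exists k, [/\ k < 6, x = vx k & nth 3 f k \in [:: i; j]].
Proof.
move=> cf i3 j3 ij; case: (boolP (x \in vs)) => [/vsP[k k6 ->]|xvs].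
  by rewrite (deg_kempe_graph_vx cf) // => H; exists k; split=> //; move: H; case: (_ \in _).
by rewrite (deg_kempe_graph_out cf).
Qed.

(** * Kempe chains, switches and the pairing of pendant edges *)

Lemma kempe_chain c f i j k : colouring c f -> i < 3 -> j < 3 -> i != j ->
  k < 6 -> nth 3 f k \in [:: i; j] ->
  exists P l, [/\ l < 6, l != k, nth 3 f l \in [:: i; j] &
                  chain (kempe_graph c i j) P (vx k) (vx l)].
Proof.
move=> cf i3 j3 ij k6 fk.
have [x||P [w [wk /(deg_kempe_graph1 cf i3 j3 ij)[l [l6 wl fl]] ch]]] :=
  @chain_exists _ _ s t (kempe_graph c i j) (vx k).
- rewrite (deg_kempe_graph _ cf) // /pattern_deg; case: (_ \in vs) => //.
  by case: eqP; case: eqP.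
- by rewrite (deg_kempe_graph_vx cf) // fk.
by exists P, l; rewrite -wl; split=> //; apply: contraNneq wk => <-; rewrite wl.
Qed.

(** Subtraction from [i + j] exchanges the colours [i] and [j]; a chain switch alters the pattern
    only at the two ends of the chain. *)
Definition swap_pattern i j k l f :=
  mkseq (fun m => if m \in [:: k; l] then i + j - nth 3 f m else nth 3 f m) 6.

(** At each vertex the chain contains all edges of colours [i] and [j] or none, so the switch only
    permutes colours there. As the Kempe graph stays the same, a linking found before the switch can
    still be used after it. *)
Lemma kempe_swap c f i j k l P : colouring c f -> i < 3 -> j < 3 -> i != j ->
  k < 6 -> l < 6 -> chain (kempe_graph c i j) P (vx k) (vx l) ->
  exists2 c', colouring c' (swap_pattern i j k l f) &
    kempe_graph c' i j = kempe_graph c i j.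
Proof.
move=> cf i3 j3 ij k6 l6 [PF Podd Pcl].
have PO e : e \in P -> e \in outside /\ (c e = i \/ c e = j).
  move=> /(subsetP PF); rewrite inE => /andP[-> /orP[/eqP|/eqP]] ->; split=> //; tauto.
exists (fun e => if e \in P then i + j - c e else c e); last first.
  apply/setP=> e; rewrite !inE; case: (boolP (e \in P)) => // eP.
  by congr (_ && _); case: (PO e eP) => _ [] ->; lia.
have [c3 cdeg] := cf.
split=> [e eO|a x a3].
  by case: (boolP (e \in P)) => [/PO[_ []] ->|_]; [lia|lia|exact: c3].
set c' := fun e => _.
(* On [P] the edges coloured [a] after the switch are those coloured [a'] before; off [P] nothing
   changes. *)
pose a' := if a == i then j else if a == j then i else a.
have a'3 : a' < 3 by rewrite /a'; case: eqP => // _; case: eqP.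
have E1 : colour_class c' a :\: P = colour_class c a :\: P.
  by apply/setP=> e; rewrite !inE /c'; case: (boolP (e \in P)).
have E2 : colour_class c' a :&: P = colour_class c a' :&: P.
  apply/setP=> e; rewrite !inE /c'; case: (boolP (e \in P)); rewrite ?andbF // !andbT.
  move=> /PO[_ ce]; congr (_ && _); rewrite /a'.
  by case: (a =P i); [|case: (a =P j)]; case: ce => ->; lia.
rewrite (deg_setID _ _ _ P) E1 E2.
have D0 b : b < 3 -> deg (colour_class c b) x =
    deg (colour_class c b :&: P) x + deg (colour_class c b :\: P) x.
  by move=> b3; rewrite (deg_setID _ _ _ P).
(* Odd degree in [P] detects the two ends of the chain. The chain is nonempty there, so both pendant
   colours are [i] or [j]. *)
have swapx : pattern_deg (swap_pattern i j k l f) a x =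
    if odd (deg P x) then pattern_deg f a' x else pattern_deg f a x.
  rewrite Podd; case: (boolP (x \in vs)) => [/vsP[m m6 ->]|xvs]; last first.
    by rewrite /pattern_deg (negPf xvs) if_same.
  rewrite !pattern_deg_vx // !vx_eq // nth_mkseq // !inE; case: ifP => // mkl.
  have : deg P (vx m) != 0 by apply/eqP => P0; have := Podd (vx m); rewrite P0 !vx_eq ?mkl.
  case: (Pcl (vx m)) => [-> //|->]; rewrite (deg_kempe_graph_vx cf) // !inE.
  rewrite eqb0 negbK /a' => /orP[] /eqP->; congr nat_of_bool;
  by case: (a =P i) => [->|/eqP ai]; [lia|case: (a =P j) => [->|/eqP aj]; lia].
have Pij : deg (colour_class c i :&: P) x + deg (colour_class c j :&: P) x = deg P x.
  rewrite -deg_disjointU -?setIUl -?kempe_graphU ?(setIidPr PF) //.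
  rewrite -setI_eq0 setIACA setIid; move: (colour_class_disjoint c ij).
  by rewrite -setI_eq0 => /eqP ->; rewrite set0I.
have Pa b : b != i -> b != j -> deg (colour_class c b :&: P) x = 0.
  move=> bi bj; suff -> : colour_class c b :&: P = set0 by rewrite deg0.
  apply/setP=> e; rewrite !inE; apply/negP=> /andP[/andP[_ /eqP ce] /PO[_]].
  by rewrite ce; lia.
have Di : pattern_deg f i x = _ := etrans (esym (cdeg i x i3)) (D0 i i3).
have Dj : pattern_deg f j x = _ := etrans (esym (cdeg j x j3)) (D0 j j3).
have Da : pattern_deg f a x = _ := etrans (esym (cdeg a x a3)) (D0 a a3).
have kF := deg_kempe_graph x cf i3 j3 ij.
have := Pcl x; rewrite kF swapx -Pij.
have := Di; have := Dj; have := Da.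
have : pattern_deg f i x <= 1 by rewrite /pattern_deg; case: ifP => // _; case: eqP.
have : pattern_deg f j x <= 1 by rewrite /pattern_deg; case: ifP => // _; case: eqP.
rewrite /a'; case: (a =P i) => [->|/eqP ai]; [|case: (a =P j) => [->|/eqP aj]].
- case: (pattern_deg f i x) => [|[|//]]; case: (pattern_deg f j x) => [|[|//]] _ _ _ pj pi;
  case=> pp; try rewrite pp /=; lia.
- case: (pattern_deg f i x) => [|[|//]]; case: (pattern_deg f j x) => [|[|//]] _ _ _ pj pi;
  case=> pp; try rewrite pp /=; lia.
by rewrite if_same Pa //; lia.
Qed.

(** The sum of cardinalities makes the three parts edge-disjoint. Parities stand in for paths: they
    are all that is needed to close [P] and [Q] to even subgraphs inside the hexagon. *)
Definition linked F k l k' l' := exists P Q R,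
  [/\ F = P :|: Q :|: R, #|P| + #|Q| + #|R| = #|F|,
      forall x, odd (deg P x) = (x \in [:: vx k; vx l]),
      forall x, odd (deg Q x) = (x \in [:: vx k'; vx l']) &
      even_subgraph R].

(** Only four pendant edges have the two colours, so removing the chain from [k] to [l] leaves two
    odd vertices; a second chain joins [k'] to [l'], and the remainder is even. *)
Lemma kempe_linked c f i j k l k' l' P :
  colouring c f -> i < 3 -> j < 3 -> i != j ->
  chain (kempe_graph c i j) P (vx k) (vx l) ->
  perm_eq [seq m <- iota 0 6 | nth 3 f m \in [:: i; j]] [:: k; l; k'; l'] ->
  linked (kempe_graph c i j) k l k' l'.
Proof.
move=> cf i3 j3 ij [PF Podd Pcl] pend.
have pendP m : m \in [:: k; l; k'; l'] = (m < 6) && (nth 3 f m \in [:: i; j]).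
  by rewrite -(perm_mem pend) mem_filter mem_iota andbC.
have : uniq [:: k; l; k'; l'] by rewrite -(perm_uniq pend) filter_uniq ?iota_uniq.
rewrite /= !inE !negb_or => /and4P[/and3P[kl kk' kl'] /andP[lk' ll'] k'l' _].
have [[k6 fk] [l6 fl] [k'6 fk'] [l'6 fl']] :
    [/\ k < 6 /\ nth 3 f k \in [:: i; j], l < 6 /\ nth 3 f l \in [:: i; j],
        k' < 6 /\ nth 3 f k' \in [:: i; j] & l' < 6 /\ nth 3 f l' \in [:: i; j]].
  by split; apply/andP; rewrite -pendP !inE eqxx ?orbT.
set F := kempe_graph c i j in PF Pcl *.
have degF x : deg F x = deg P x + deg (F :\: P) x.
  by rewrite (deg_setID _ _ F P) (setIidPr PF).
have k'P : deg P (vx k') = 0.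
  have := Podd (vx k'); case: (Pcl (vx k')) => // ->.
  by rewrite !vx_eq // (deg_kempe_graph_vx cf) // fk' !(eq_sym k') (negPf kk') (negPf lk').
have [x||Q [w [wk' Fw [QF Qodd Qcl]]]] := @chain_exists _ _ s t (F :\: P) (vx k').
- apply: leq_trans (_ : deg F x <= 2); first by rewrite degF leq_addl.
  rewrite (deg_kempe_graph _ cf) // /pattern_deg; case: (_ \in vs) => //.
  by case: eqP; case: eqP.
- by have := degF (vx k'); rewrite k'P (deg_kempe_graph_vx cf) // fk' add0n => <-.
(* [w] meets an edge of [F] outside [P], so closedness of [P] gives it degree 0 in [P]. It is thus a
   pendant end other than [k], [l] and [k'], that is, [l']. *)
have {}Fw : deg F w = 1 /\ deg P w = 0.
  by move: (degF w) (Pcl w); rewrite Fw; clear; lia.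
have [m [m6 wm fm]] := deg_kempe_graph1 cf i3 j3 ij (proj1 Fw).
have ml' : m = l'.
  have := pendP m; rewrite m6 fm !inE; case: (m =P l') => // _; rewrite orbF.
  have := Podd w; rewrite (proj2 Fw) wm !vx_eq //= => /esym/norP[/negPf -> /negPf ->] /=.
  by move=> /eqP mk'; move: wk'; rewrite wm mk' eqxx.
have QP : Q \subset F by rewrite (subset_trans QF) ?subsetDl.
exists P, Q, (F :\: P :\: Q); split.
- apply/setP=> e; rewrite !in_setU !in_setD; move: (subsetP PF e) (subsetP QP e).
  case: (e \in P) => [/(_ isT) -> //|_]; case: (e \in Q) => [/(_ isT) -> //|_].
  by case: (e \in F).
- have := cardsID P F; have := cardsID Q (F :\: P).
  by rewrite (setIidPr PF) (setIidPr QF) -addnA => -> ->.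
- by move=> x; rewrite Podd !inE.
- by move=> x; rewrite Qodd !inE wm ml'.
apply/forallP => x; apply/negP => oR.
have := degF x; have := deg_setID s t (F :\: P) Q x; rewrite (setIidPr QF) => -> /(congr1 odd).
rewrite !oddD oR Podd Qodd wm ml'.
case: (boolP (x \in vs)) => [/vsP[n n6 ->]|xvs].
  rewrite (deg_kempe_graph_vx cf) // !vx_eq //.
  have := pendP n; rewrite n6 /= => <-; rewrite !inE oddb.
  have := kl; have := kk'; have := kl'; have := lk'; have := ll'; have := k'l'.
  by case: (n =P k) => [->|_]; [|case: (n =P l) => [->|_]; [|case: (n =P k') => [->|_];
    [|case: (n =P l')]]]; rewrite ?eqxx //=; do !case: eqP.
rewrite (deg_kempe_graph_out cf) //.
have out m' : m' < 6 -> (x == vx m') = false.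
  by move=> m'6; apply: contraNF xvs => /eqP ->; apply: vx_mem.
by rewrite !out.
Qed.

(** The end [l] is not prescribed, so each application splits on it; every outcome offers a switch
    and, once the other two ends are named, a linking. *)
Lemma kempe_step c f i j k : colouring c f -> i < 3 -> j < 3 -> i != j ->
  k < 6 -> nth 3 f k \in [:: i; j] ->
  exists l, [/\ [&& l < 6, l != k & nth 3 f l \in [:: i; j]],
    exists2 c', colouring c' (swap_pattern i j k l f) &
      kempe_graph c' i j = kempe_graph c i j &
    forall k' l',
      perm_eq [seq m <- iota 0 6 | nth 3 f m \in [:: i; j]] [:: k; l; k'; l'] ->
      linked (kempe_graph c i j) k l k' l'].
Proof.
move=> cf i3 j3 ij k6 fk.
have [P [l [l6 lk fl ch]]] := kempe_chain cf i3 j3 ij k6 fk.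
exists l; split; first by rewrite l6 lk fl.
  exact: kempe_swap ch.
by move=> k' l'; apply: kempe_linked ch.
Qed.

(** * Closing chains inside the hexagon *)

Definition arc X : {set E} := [set e | e \in [seq hx k | k <- X]].
(** Degrees computed on indices, so that concrete closings and hexagon colourings are checked by
    evaluation. *)
Definition arc_deg X m := sumn [seq (m == k) + (m == k.+1 %% 6) | k <- X].
Definition closing X k l :=
  [&& uniq X, all (gtn 6) X &
      all (fun m => odd (arc_deg X m) == (m \in [:: k; l])) (iota 0 6)].

Lemma deg_arc X x : uniq X -> all (gtn 6) X ->
  deg (arc X) x = \sum_(k <- X) inc (hx k) x.
Proof.
move=> uX /allP X6; rewrite -(big_map hx predT (fun e => inc e x)) big_uniq; last first.
  rewrite map_inj_in_uniq // => k l /X6 k6 /X6 l6 /eqP.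
  by rewrite nth_uniq ?size_hs // => /eqP.
by apply: eq_bigl => e; rewrite inE.
Qed.

Lemma deg_arc_vx X m : uniq X -> all (gtn 6) X -> m < 6 ->
  deg (arc X) (vx m) = arc_deg X m.
Proof.
move=> uX X6 m6; rewrite deg_arc // /arc_deg sumnE big_map.
apply: eq_big_seq => k /(allP X6) /= k6.
by rewrite hexagon // !vx_eq // ltn_pmod.
Qed.

Lemma deg_arc_out X x : uniq X -> all (gtn 6) X -> x \notin vs -> deg (arc X) x = 0.
Proof.
move=> uX X6 xvs; rewrite deg_arc // big1_seq // => k /(allP X6) /= k6.
rewrite hexagon //; case: eqP xvs => [->|_]; first by rewrite vx_mem.
by case: eqP => [->|_]; first by rewrite vx_mem ?ltn_pmod.
Qed.

Lemma arc_outside X : all (gtn 6) X -> [disjoint outside & arc X].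
Proof.
move=> X6; rewrite -setI_eq0; apply/eqP/setP=> e; rewrite !inE.
apply/negP => /andP[eh /mapP[k /(allP X6) /= k6 ek]].
by move: eh; rewrite ek mem_nth ?size_hs.
Qed.

Lemma card_arc X : #|arc X| <= size X.
Proof.
rewrite -(size_map hx) -[leqRHS]count_predT -size_filter filter_predT.
by rewrite cardsE card_size.
Qed.

Lemma even_closing P X k l : P \subset outside -> k < 6 -> l < 6 ->
  (forall x, odd (deg P x) = (x \in [:: vx k; vx l])) -> closing X k l ->
  even_subgraph (P :|: arc X).
Proof.
move=> PO k6 l6 Podd /and3P[uX X6 /allP Xodd]; apply/forallP => x.
rewrite deg_disjointU ?(disjointWl PO) ?arc_outside // oddD Podd.
case: (boolP (x \in vs)) => [/vsP[m m6 ->]|xvs].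
  rewrite deg_arc_vx // (eqP (Xodd m _)) ?mem_iota // !inE !vx_eq //.
  by rewrite addbb.
rewrite deg_arc_out // addbF !inE.
by apply: contra xvs => /orP[] /eqP ->; apply: vx_mem.
Qed.

Lemma linked_cover F k l k' l' X Y : F \subset outside -> all (gtn 6) [:: k; l; k'; l'] ->
  linked F k l k' l' -> closing X k l -> closing Y k' l' ->
  exists cs, [/\ all even_subgraph cs,
    forall e, e \in F :|: arc (X ++ Y) -> has (fun C : {set E} => e \in C) cs &
    cover_length cs <= #|F| + size X + size Y].
Proof.
move=> FO /= /and5P[k6 l6 k'6 l'6 _] [P [Q [R [FE cardF Podd Qodd Reven]]]] Xcl Ycl.
have [PO QO] : P \subset outside /\ Q \subset outside.
  by move: FO; rewrite FE !subUset => /andP[/andP[]].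
exists [:: P :|: arc X; Q :|: arc Y; R]; split.
- by rewrite /= Reven (even_closing PO k6 l6) ?(even_closing QO k'6 l'6).
- move=> e; rewrite FE !inE /= !inE map_cat mem_cat orbF.
  by do !case: (e \in _).
rewrite /cover_length !big_cons big_nil -cardF.
have := card_arc X; have := card_arc Y.
have := card_setU_le P (arc X); have := card_setU_le Q (arc Y).
clear; lia.
Qed.

Definition short_cover := exists cs : seq {set E},
  cycle_cover s t cs /\ 3 * cover_length cs <= 4 * #|E| + 3.

Lemma outside_or_arc X e : all (fun k => k \in X) (iota 0 6) ->
  (e \in outside) || (e \in arc X).
Proof.
move=> /allP allX; rewrite !inE; case: (boolP (e \in hs)) => //= ehs.
rewrite -(nth_index e0 ehs) map_f // allX // mem_iota /=.
by rewrite -size_hs index_mem.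
Qed.

(** Each colour class has (|V| - 4)/2 edges. The 01-graph and the 02-graph use four classes in all,
    colour 0 twice; with at most 9 hexagon edges the length is at most 2|V| + 1 = 4m/3 + 1. *)
Lemma cover_of_links c f k1 l1 k1' l1' k2 l2 k2' l2' X1 Y1 X2 Y2 :
  colouring c f -> [:: size f; count_mem 0 f; count_mem 1 f; count_mem 2 f] = [:: 6; 2; 2; 2] ->
  linked (kempe_graph c 0 1) k1 l1 k1' l1' -> linked (kempe_graph c 0 2) k2 l2 k2' l2' ->
  all (gtn 6) [:: k1; l1; k1'; l1'] && all (gtn 6) [:: k2; l2; k2'; l2'] ->
  closing X1 k1 l1 && closing Y1 k1' l1' -> closing X2 k2 l2 && closing Y2 k2' l2' ->
  all (fun k => k \in X1 ++ Y1 ++ X2 ++ Y2) (iota 0 6) ->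
  size X1 + size Y1 + size X2 + size Y2 <= 9 -> short_cover.
Proof.
move=> cf [f6 f0 f1 f2] L1 L2 /andP[A1 A2] /andP[cX1 cY1] /andP[cX2 cY2] allX size9.
have KO i j : kempe_graph c i j \subset outside.
  by apply/subsetP=> e; rewrite !inE => /andP[].
have [cs1 [even1 has1 len1]] := linked_cover (KO _ _) A1 L1 cX1 cY1.
have [cs2 [even2 has2 len2]] := linked_cover (KO _ _) A2 L2 cX2 cY2.
exists (cs1 ++ cs2); split; first split; first by rewrite all_cat even1.
  move=> e; rewrite has_cat; apply/orP.
  have [eO|eA] := orP (outside_or_arc e allX).
    have := (cf.1 e eO); have : e \in outside := eO.
    rewrite inE => eh; case ce: (c e) => [|[|[|//]]] _.
    - by left; apply: has1; rewrite !inE eh ce.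
    - by left; apply: has1; rewrite !inE eh ce.
    - by right; apply: has2; rewrite !inE eh ce.
  move: eA; rewrite inE !map_cat !mem_cat => /or4P[] eA;
    [left; apply: has1|left; apply: has1|right; apply: has2|right; apply: has2];
    by rewrite !inE map_cat mem_cat eA ?orbT.
have -> : cover_length (cs1 ++ cs2) = cover_length cs1 + cover_length cs2 by exact: big_cat.
have K1 : #|kempe_graph c 0 1| <= #|colour_class c 0| + #|colour_class c 1|.
  by rewrite kempe_graphU card_setU_le.
have K2 : #|kempe_graph c 0 2| <= #|colour_class c 0| + #|colour_class c 2|.
  by rewrite kempe_graphU card_setU_le.
have := card_colour_class cf f6 (isT : 0 < 3); have := card_colour_class cf f6 (isT : 1 < 3).
have := card_colour_class cf f6 (isT : 2 < 3); rewrite f0 f1 f2.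
move: (card_edges cubicG) K1 K2 len1 len2 size9; clear; lia.
Qed.

(** * Outside colourings against colourings and matchings of the whole graph *)

Lemma colourable_hexagon c f hc : colouring c f -> size hc = 6 ->
  all (gtn 3) hc ->
  all (fun i => all (fun m => (nth 3 f m == i) +
         arc_deg [seq k <- iota 0 6 | nth 3 hc k == i] m <= 1) (iota 0 6)) (iota 0 3) ->
  three_edge_colourable s t.
Proof.
move=> [c3 cf] hc6 /allP hc3 /allP ok.
exists [ffun e => inord (if e \in outside then c e else nth 3 hc (index e hs)) : 'I_3].
move=> x i; set X := [seq k <- iota 0 6 | nth 3 hc k == i].
have uX : uniq X by rewrite filter_uniq ?iota_uniq.
have X6 : all (gtn 6) X.
  by apply/allP => k; rewrite mem_filter mem_iota => /andP[].
have -> : [set e | [ffun e => inord (if e \in outside then c e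
    else nth 3 hc (index e hs)) : 'I_3] e == i] = colour_class c i :|: arc X.
  apply/setP=> e; rewrite !inE ffunE -val_eqE /=.
  case: (boolP (e \in hs)) => eh /=.
    have i6 : index e hs < 6 by rewrite -size_hs index_mem.
    rewrite inE eh /= inordK; last by apply: hc3; rewrite mem_nth ?hc6.
    apply/idP/mapP => [hi|[k]].
      by exists (index e hs); rewrite ?nth_index // mem_filter hi mem_iota.
    rewrite mem_filter mem_iota => /andP[hk k6] ->.
    by rewrite index_uniq ?size_hs.
  rewrite inE eh /= inordK; last by apply: c3; rewrite inE.
  suff /negPf -> : e \notin [seq hx k | k <- X] by rewrite orbF.
  by apply: contra eh => /mapP[k /(allP X6) /= k6 ->]; rewrite mem_nth ?size_hs.
have cO : colour_class c i \subset outside by apply/subsetP=> e; rewrite inE => /andP[].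
rewrite deg_disjointU ?(disjointWl cO) ?arc_outside // cf //.
case: (boolP (x \in vs)) => [/vsP[m m6 ->]|xvs].
  rewrite pattern_deg_vx // deg_arc_vx //.
  by apply: (allP (ok i _)); rewrite mem_iota ?ltn_ord.
by rewrite deg_arc_out // /pattern_deg (negPf xvs).
Qed.

(* A colour missing on the pendant edges is a perfect matching [N] of the graph minus the
   hexagon; [N] and every second hexagon edge form a fourth perfect matching, so that the
   four matchings cover everything. *)
Lemma cover_of_matching c0 c f i : colouring c0 [:: 0; 0; 1; 1; 2; 2] ->
  colouring c f -> size f = 6 -> i < 3 -> i \notin f -> short_cover.
Proof.
move=> c0P cf f6 i3 inf; have [c03 c0deg] := c0P.
set N := colour_class c i; set A := colour_class c0.
(* Under [c0] the two vertices of pendant colour [j] are the ends of the hexagon edge of index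
   [j.*2], and [N] misses all hexagon vertices. So the symmetric difference is odd exactly at these
   ends, and that edge closes it. *)
pose Y j := ((A j :\: N) :|: (N :\: A j)) :|: arc [:: j.*2].
have NO : N \subset outside by apply/subsetP=> e; rewrite inE => /andP[].
have AO j : A j \subset outside by apply/subsetP=> e; rewrite inE => /andP[].
have DO j : (A j :\: N) :|: (N :\: A j) \subset outside.
  by rewrite subUset !(subset_trans (subsetDl _ _)).
have Neven j : j < 3 -> even_subgraph (Y j).
  move=> j3; have [j6 j6'] : j.*2 < 6 /\ j.*2.+1 < 6 by split; clear -j3; lia.
  apply: (even_closing (DO j) j6 j6') => [x|]; last first.
    by move: j3; clear; case: j => [|[|[|]]].
  rewrite odd_deg_symdiff c0deg // (proj2 cf) //.
  case: (boolP (x \in vs)) => [/vsP[m m6 ->]|xvs].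
    rewrite !pattern_deg_vx // (_ : nth 3 f m == i = false); last first.
      by apply: contraNF inf => /eqP <-; rewrite mem_nth ?f6.
    rewrite !inE !vx_eq //; move: m6 j3; clear.
    by case: j => [|[|[|//]]]; case: m => [|[|[|[|[|[|//]]]]]].
  rewrite /pattern_deg (negPf xvs) !inE; apply/esym/negbTE.
  by apply: contra xvs => /orP[] /eqP ->; apply: vx_mem.
(* An outside edge lies in a single [A j]: it is covered by [Y j] if it avoids [N], and by the other
   two sets otherwise. *)
exists [:: arc (iota 0 6); Y 0; Y 1; Y 2]; split; first split.
- rewrite /= !Neven // !andbT; apply/forallP => x.
  case: (boolP (x \in vs)) => [/vsP[m m6 ->]|xvs]; last by rewrite deg_arc_out.
  by rewrite deg_arc_vx //; move: m m6; do 6!case=> //.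
- move=> e; rewrite /=; have [eO|-> //] := orP (@outside_or_arc (iota 0 6) e isT).
  have := c03 e eO; have : e \in outside := eO.
  rewrite !inE => eh; case ce: (c0 e) => [|[|[|//]]] _; rewrite eh /=;
    by case: (c e == i); rewrite ?orbT.
have cA j : j < 3 -> 2 * #|A j| + 6 = #|V| + 2.
  move=> j3; rewrite (card_colour_class c0P) //; congr (_ + _).
  by move: j3; case: j => [|[|[|]]].
have cN : 2 * #|N| + 6 = #|V|.
  by rewrite (card_colour_class cf) // (count_memPn inf) addn0.
have cY j : #|Y j| + 2 * #|A j :&: N| <= #|A j| + #|N| + 1.
  have := card_arc [:: j.*2]; have := card_setU_le (A j :\: N :|: N :\: A j) (arc [:: j.*2]).
  have := card_setU_le (A j :\: N) (N :\: A j).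
  have := cardsID N (A j); have := cardsID (A j) N; rewrite (setIC N) -/(Y j) /=.
  clear; lia.
have NI : #|N| <= #|A 0 :&: N| + #|A 1 :&: N| + #|A 2 :&: N|.
  have NE : N = (A 0 :&: N) :|: (A 1 :&: N) :|: (A 2 :&: N).
    apply/setP=> e; rewrite !in_setU !in_setI.
    case: (boolP (e \in N)) => eN; last by rewrite !andbF.
    have eO := subsetP NO e eN; have := c03 e eO.
    rewrite !andbT !inE; have := eO; rewrite inE => ->.
    by case: (c0 e) => [|[|[|]]].
  rewrite {1}NE; apply: leq_trans (card_setU_le _ _) _; rewrite leq_add2r.
  exact: card_setU_le.
(* The classes [A j] have (|V| - 4)/2 edges and [N] has (|V| - 6)/2, so the three sets [Y j] have at
   most 2|V| - 6 edges together; with the hexagon this makes 2|V| = 4m/3. *)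
rewrite /cover_length !big_cons big_nil.
have := card_arc (iota 0 6); have := cY 0; have := cY 1; have := cY 2.
have := cA 0 isT; have := cA 1 isT; have := cA 2 isT; have := card_edges cubicG.
by rewrite size_iota; lia.
Qed.

Definition cover_count (M : nat -> {set E}) e : nat :=
  (e \in M 0) + (e \in M 1) + (e \in M 2).

(** Inside the hexagon [M j] misses exactly the vertices of indices [j.*2] and [j.*2.+1], so the
    outside edges at these two have colour [j]. *)
Lemma colouring_of_matchings (M : nat -> {set E}) :
  (forall j x, j < 3 -> deg (M j) x = 1) ->
  (forall e, e \notin hs -> cover_count M e = 1) ->
  (forall j k, j < 3 -> k < 6 -> (hx k \in M j) = ~~ odd k && (k != j.*2)) ->
  exists c, colouring c [:: 0; 0; 1; 1; 2; 2].
Proof.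
move=> PM M1 Mh; pose c e := if e \in M 0 then 0 else if e \in M 1 then 1 else 2.
exists c; split=> [e _|j x j3]; first by rewrite /c; case: ifP => // _; case: ifP.
pose X := [seq k <- iota 0 6 | ~~ odd k && (k != j.*2)].
have uX : uniq X by rewrite filter_uniq ?iota_uniq.
have X6 : all (gtn 6) X by apply/allP => k; rewrite mem_filter mem_iota => /andP[].
have ME : M j = colour_class c j :|: arc X.
  apply/setP=> e; rewrite !inE; case: (boolP (e \in hs)) => eh /=.
    have i6 : index e hs < 6 by rewrite -size_hs index_mem.
    rewrite -{1}(nth_index e0 eh) Mh //; apply/idP/mapP => [hi|[k]].
      by exists (index e hs); rewrite ?nth_index // mem_filter hi mem_iota.
    rewrite mem_filter mem_iota => /andP[hk k6] ->.
    by rewrite index_uniq ?size_hs.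
  have /negPf -> : e \notin [seq hx k | k <- X].
    by apply: contra eh => /mapP[k /(allP X6) /= k6 ->]; rewrite mem_nth ?size_hs.
  rewrite orbF /c; move: (M1 e eh); rewrite /cover_count; move: j3; clear.
  by case: j => [|[|[|//]]] _; do 3!case: (e \in _).
have cO : colour_class c j \subset outside by apply/subsetP=> e; rewrite inE => /andP[].
have := PM j x j3; rewrite ME deg_disjointU ?(disjointWl cO) ?arc_outside //.
case: (boolP (x \in vs)) => [/vsP[m m6 ->]|xvs]; last first.
  by rewrite deg_arc_out // addn0 /pattern_deg (negPf xvs).
rewrite pattern_deg_vx // deg_arc_vx // /X; move: (deg _ _) m6 j3; clear=> d.
by case: j => [|[|[|//]]]; case: m => [|[|[|[|[|[|//]]]]]] _ _;
  rewrite /arc_deg /= ?addn0 => //; clear; lia.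
Qed.

(** * Case analysis on the Kempe chains *)

Hypothesis uncolourable : ~ three_edge_colourable s t.

Lemma hexagon_short_cover c : colouring c [:: 0; 0; 1; 1; 2; 2] -> short_cover.
Proof.
move=> cA.
have M4 c' f i : colouring c' f -> size f = 6 -> i < 3 -> i \notin f -> short_cover.
  exact: cover_of_matching cA.
(* The 01-chain from vertex 0. If it ends at 1, the switch removes colour 0 from the pendant edges;
   if at 2, the new pattern 1,0,0,1,2,2 extends to the whole graph; if at 3, the pattern becomes
   1,0,1,0,2,2. *)
have [l [+ + link01]] := @kempe_step _ _ 0 1 0 cA isT isT isT isT isT.
case: l link01 => [|[|[|[|[|[|l]]]]]] // link01 _ [cB cBP kB].
- exact: (M4 _ _ 0 cBP).
- by case: uncolourable; apply: (@colourable_hexagon _ _ [:: 2; 1; 2; 0; 1; 0] cBP).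
have {}cBP : colouring cB [:: 1; 0; 1; 0; 2; 2] := cBP.
have {link01} := link01 1 2 isT; rewrite -kB => link01.
(* The 02-chain from vertex 1. If it ends at 3, the switch removes colour 0. If at 4, the chains
   pair 0-3, 1-2 in colours 01 and 1-4, 3-5 in colours 02, closed by 3+1+3+2 edges. If at 5, the
   switch is made. *)
have [m [+ + link02]] := @kempe_step _ _ 0 2 1 cBP isT isT isT isT isT.
case: m link02 => [|[|[|[|[|[|m]]]]]] // link02 _ [cC cCP kC].
- exact: (M4 _ _ 0 cCP).
- exact: (@cover_of_links _ _ _ _ _ _ _ _ _ _ [:: 0; 1; 2] [:: 1] [:: 0; 4; 5] [:: 3; 4]
    cBP erefl link01 (link02 3 5 isT)).
have {}cCP : colouring cC [:: 1; 2; 1; 0; 2; 0] := cCP.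
have {link02} := link02 3 4 isT; rewrite -kC => link02.
(* The 02-switch may alter the 01-chains, so the one from vertex 0 is followed afresh; the 02-chains
   now pair 1-5 and 3-4. An end at 2 lets the switch remove colour 1; both other ends give a
   cover. *)
have [n [+ + {}link01]] := @kempe_step _ _ 0 1 0 cCP isT isT isT isT isT.
case: n link01 => [|[|[|[|[|[|n]]]]]] // link01 _ [cD cDP kD].
- exact: (M4 _ _ 1 cDP).
- exact: (@cover_of_links _ _ _ _ _ _ _ _ _ _ [:: 0; 1; 2] [:: 2; 3; 4] [:: 0; 5] [:: 3]
    cCP erefl (link01 2 5 isT) link02).
(* The chain 0-5 is closed the long way round, since otherwise hexagon edges 1 and 4 would stay
   uncovered. *)
exact: (@cover_of_links _ _ _ _ _ _ _ _ _ _ [:: 0; 1; 2; 3; 4] [:: 2] [:: 0; 5] [:: 3]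
  cCP erefl (link01 2 3 isT) link02).
Qed.

End Hexagon.

(** * Optimal triples of perfect matchings and their hexagon *)

Section MatchingTriples.
Variables (V E : finType) (s t : E -> V).
Implicit Types (F : {set E}) (e a b : E) (x y z : V) (M : nat -> {set E}) (A Z : seq E).

Local Notation deg := (deg s t).
Local Notation inc := (inc s t).
Local Notation joins := (joins s t).

Definition matchings M := forall j x, j < 3 -> deg (M j) x = 1.
Definition uncovered_by M := [set e | cover_count M e == 0].

Variable M : nat -> {set E}.
Hypothesis PM : matchings M.
Hypothesis cubicG : cubic s t.
Hypothesis G2 : two_connected s t.
Hypothesis cardU : #|uncovered_by M| = 3.
Hypothesis minU : forall M', matchings M' -> 3 <= #|uncovered_by M'|.

Local Notation U := (uncovered_by M).
Let B := [set e | 2 <= cover_count M e].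
Let T := [set e | cover_count M e == 3].

Lemma degE F x : deg F x = \sum_e (e \in F) * inc e x.
Proof.
rewrite /Defs.deg big_mkcond; apply: eq_bigr => e _.
by case: (e \in F); rewrite ?mul1n ?mul0n.
Qed.

(** The three matching degrees at [x] add up to its degree 3, and an edge covered n times satisfies
    [n = 0] + n = 1 + [n >= 2] + [n = 3]. *)
Lemma deg_uncovered x : deg U x = deg B x + deg T x.
Proof.
suff : deg U x + (deg (M 0) x + deg (M 1) x + deg (M 2) x) =
       deg [set: E] x + (deg B x + deg T x).
  by rewrite cubicG !PM //; clear; lia.
rewrite !degE -!big_split /=; apply: eq_bigr => e _.
rewrite !inE /cover_count -!mulnDl; congr (_ * _); clear.
by do 3!case: (e \in _).
Qed.

Lemma deg_covered_twice x : 2 * deg B x + deg T x <= 3.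
Proof.
suff : 2 * deg B x + deg T x <= deg (M 0) x + deg (M 1) x + deg (M 2) x.
  by rewrite !PM //; clear; lia.
rewrite !degE big_distrr -!big_split /=; apply: leq_sum => e _.
rewrite !inE /cover_count mulnA -!mulnDl leq_mul2r; apply/orP; right; clear.
by do 3!case: (e \in _).
Qed.

Lemma deg_seq A x : uniq A -> deg [set e in A] x = \sum_(e <- A) inc e x.
Proof. by move=> uA; rewrite big_uniq //; apply: eq_bigl => e; rewrite inE. Qed.

(* Switching one of the matchings along a cycle whose edges are alternately uncovered and
   covered at least twice would reduce the number of uncovered edges. *)
Lemma no_switch j A Z : j < 3 -> uniq A -> uniq Z -> A != [::] ->
  all [in U] A -> all [in B] Z -> all [in M j] Z ->
  ~ (forall x, \sum_(e <- A) inc e x = \sum_(e <- Z) inc e x).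
Proof.
move=> j3 uA uZ A0 /allP AU /allP ZB /allP ZM AZ.
pose M' i := if i == j then (M j :\: [set e in Z]) :|: [set e in A] else M i.
have M'P : matchings M'.
  move=> i x i3; rewrite /M'; case: (i =P j) => [_|_]; last exact: PM.
  rewrite deg_disjointU; last first.
    rewrite -setI_eq0; apply/eqP/setP=> e; rewrite !inE.
    apply/negP=> /andP[/andP[_ eM] /AU]; rewrite inE /cover_count.
    by move: j3 eM; clear; case: j => [|[|[|//]]] _ ->; rewrite ?addn1 // addnC.
  have ZsM : [set e in Z] \subset M j by apply/subsetP=> e; rewrite inE => /ZM.
  have := PM x j3; rewrite (deg_setID s t (M j) [set e in Z]) (setIidPr ZsM).
  by rewrite !deg_seq // AZ addnC.
case: A A0 AU {uA AZ} @M' M'P => // a A _ AU M' M'P.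
(* Edges of [Z] remain covered by another matching and those of [A] become covered, so at least [a]
   is gained. *)
suff : uncovered_by M' \subset U :\ a.
  move=> /subset_leq_card; have := minU M'P.
  by have := cardsD1 a U; rewrite AU ?mem_head // cardU; clear; lia.
apply/subsetP=> e; rewrite !inE /cover_count /M'.
have := ZB e; rewrite inE /cover_count; move: j3; clear.
case: j => [|[|[|//]]] _; rewrite /= !inE;
  case: (e == a) => //=; case: (e \in A) => //=; rewrite ?addn0 ?orbF ?orbT;
  by case: (e \in Z) => [/(_ isT)|_]; case: (e \in M 0); case: (e \in M 1); case: (e \in M 2).
Qed.

(** This excludes graphs on two vertices, where 2-connectivity does not forbid loops. *)
Lemma card_edges_gt3 : 3 < #|E|.
Proof.
have /card_gt0P[a aU] : 0 < #|U| by rewrite cardU.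
have [b [_ [bM _]]] : exists b y, b \in M 0 /\ joins b (s a) y.
  by apply: deg_gt0; rewrite PM.
rewrite -cardU -cardsT proper_card // properE subsetT; apply/subsetPn; exists b => //.
by rewrite inE /cover_count bM.
Qed.

(** A vertex with a loop has one further edge, whose other end [y'] would be a cut vertex as soon as
    a third vertex exists; having more than three edges provides one. *)
Lemma loopless e x : inc e x <= 1.
Proof.
rewrite leqNgt; apply/negP=> loop.
have [y Jy] := inc_joins (ltnW loop).
have {Jy} Je : joins e x x.
  by move: loop; rewrite Jy eqxx; case: eqP Jy => // <-.
have degx := cubicG x.
rewrite (deg_setD1 s t x (in_setT e)) Je eqxx in degx.
have [e' [y' [e'e Je']]] : exists e' y, e' \in [set: E] :\ e /\ joins e' x y.
  by apply: deg_gt0; move: degx; clear; lia.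
have yx : y' != x.
  have := deg_inc s t x e'e; rewrite Je' eqxx eq_sym.
  by case: eqP => // _; move: degx; clear; lia.
have near d w : 0 < inc d x -> 0 < inc d w -> w != y' -> w = x.
  move=> dx dw wy; case: (eqVneq d e) dw => [->|de dw].
    by rewrite Je; case: eqP.
  have de' : d = e'.
    apply: (@deg_le1_inj _ _ s t ([set: E] :\ e) x) => //.
    - by move: degx; clear; lia.
    - by rewrite !inE de.
    - exact: joins_gt0 Je'.
  by move: dw wy; rewrite de' => /(joins_end Je')[->|->]; rewrite ?eqxx.
have closedx : closed (adj_avoid s t y') (pred1 x).
  move=> u w /and3P[uy wy /existsP[d dP]].
  have [du dw] : 0 < inc d u /\ 0 < inc d w.
    by move: dP; rewrite /Defs.inc => /orP[] /andP[/eqP-> /eqP->];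
      rewrite !eqxx ?addn1.
  rewrite !inE; apply/eqP/eqP => [ux|wx].
    by apply: (near d) => //; rewrite -ux.
  by apply: (near d) => //; rewrite -wx.
have Vxy : #|V| <= 2.
  rewrite -cardsT; apply: leq_trans (_ : #|[set x; y']| <= 2); last first.
    by rewrite cards2; case: (_ != _).
  apply/subset_leq_card/subsetP => w _; rewrite !inE.
  case: (eqVneq w y') => [|wy]; first by rewrite orbT.
  have := closed_connect closedx (proj2 G2 y' x w _ wy).
  by rewrite !inE eqxx eq_sym => <- //; rewrite eq_sym.
have := card_edges cubicG; have := card_edges_gt3; move: Vxy; clear; lia.
Qed.

Lemma joins_neq e x y : joins e x y -> x != y.
Proof.
move=> J; have := loopless e x; rewrite J eqxx.
by case: (x == y).
Qed.

(** Pigeonhole: each of [a] and [b] lies in at least two of three matchings. This provides the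
    matching in which to switch. *)
Lemma common_matching a b : a \in B -> b \in B ->
  exists j, [/\ j < 3, a \in M j & b \in M j].
Proof.
rewrite !inE /cover_count.
case a0 : (a \in M 0); case b0 : (b \in M 0); try by exists 0.
all: case a1 : (a \in M 1); case b1 : (b \in M 1); try by exists 1.
all: case a2 : (a \in M 2); case b2 : (b \in M 2); try by exists 2.
all: by [].
Qed.

Lemma thriceB : {subset T <= B}.
Proof. by move=> e; rewrite !inE => /eqP ->. Qed.

Lemma degB_le1 x : deg B x <= 1.
Proof. by have := deg_covered_twice x; clear; lia. Qed.

Lemma B_inj x a b : a \in B -> b \in B -> 0 < inc a x -> 0 < inc b x -> a = b.
Proof. exact: deg_le1_inj (degB_le1 x). Qed.

Lemma B_at_U a x : a \in U -> 0 < inc a x -> exists b y, b \in B /\ joins b x y.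
Proof.
move=> aU ax; apply: deg_gt0.
have := deg_inc s t x aU; have := deg_uncovered x.
have := deg_mono s t x (introT subsetP thriceB).
by move: ax; clear; lia.
Qed.

Lemma U_at_B b x : b \in B -> 0 < inc b x -> exists a y, a \in U /\ joins a x y.
Proof.
move=> bB bx; apply: deg_gt0.
by have := deg_inc s t x bB; have := deg_uncovered x; move: bx; clear; lia.
Qed.

(** Both ends [u], [v] of such an edge would meet two uncovered edges. As only three are uncovered,
    the alternating path from [u] returns to [v] after at most three edges, and switching the
    resulting digon or square contradicts minimality. *)
Lemma no_thrice e : e \notin T.
Proof.
apply/negP => eT; have eB := thriceB eT.
have eM j : j < 3 -> e \in M j.
  move: eT; rewrite inE /cover_count; clear.
  by case: j => [|[|[|//]]]; do 3!case: (e \in _).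
have := joins_ends s t e; set u := s e; set v := t e => Je.
have eU x : 0 < inc e x -> 2 <= deg U x.
  move=> ex; have := deg_uncovered x.
  by have := deg_inc s t x eT; have := deg_inc s t x eB; move: ex; clear; lia.
have [f [x [fU Jf]]] := U_at_B eB (joins_gt0 Je).
have [eu ev] := (joins_gt0 Je, joins_gt0 (joinsC Je)).
case: (eqVneq x v) => [xv|xv].
  apply: (@no_switch 0 [:: f] [:: e]); rewrite /= ?fU ?eB ?eM //.
  by move=> z; rewrite !big_seq1 Jf Je xv.
have [b [y [bB Jb]]] := B_at_U fU (joins_gt0 (joinsC Jf)).
have [bx by_] := (joins_gt0 Jb, joins_gt0 (joinsC Jb)).
have be : b != e.
  apply/eqP=> be; have := joins_end Je; move/(_ x); rewrite -be => /(_ bx) [xu|xv'].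
    by have := joins_neq Jf; rewrite xu eqxx.
  by rewrite xv' eqxx in xv.
have [yu yv] : y != u /\ y != v.
  by split; apply: contraNneq be => E'; apply/eqP/(@B_inj y); rewrite // E'.
have [g [z [gU Jg]]] := U_at_B bB by_.
have fg : f != g.
  apply/eqP=> fg; have gy := joins_gt0 Jg; rewrite -fg in gy.
  case: (joins_end Jf gy) => [/eqP|yx]; first by rewrite (negPf yu).
  by have := joins_neq Jb; rewrite yx eqxx.
(* At least two uncovered edges meet [v] and [f] does not, so both of the others do. *)
have gv : 0 < inc g v.
  have := eU v ev; rewrite (deg_setD1 s t v fU) Jf.
  rewrite (eq_sym v u) (negPf (joins_neq Je)) (eq_sym v x) (negPf xv) add0n.
  have gU' : g \in U :\ f by rewrite in_setD1 eq_sym fg.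
  rewrite (deg_setD1 s t v gU').
  have : deg (U :\ f :\ g) v <= #|U :\ f :\ g|.
    by rewrite /Defs.deg -sum1_card; apply: leq_sum => h _; apply: loopless.
  have := cardsD1 f U; have := cardsD1 g (U :\ f); rewrite gU' fU cardU.
  by clear; lia.
have zv : z = v by case: (joins_end Jg gv) => // /eqP; rewrite eq_sym (negPf yv).
have [j [j3 bM eMj]] := common_matching bB eB.
apply: (@no_switch j [:: f; g] [:: b; e]); rewrite /= ?mem_seq1 ?fg ?be ?fU ?gU ?bB ?eB ?bM ?eMj //.
by move=> w; rewrite !big_cons !big_nil Jf Jg Jb Je zv; clear; lia.
Qed.

(** With no triply covered edge, uncovered and doubly covered edges have equal degrees, so together
    they form alternating cycles. *)
Lemma degU_le1 x : deg U x <= 1.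
Proof.
have -> : deg U x = deg B x; last exact: degB_le1.
rewrite deg_uncovered (_ : T = set0) ?deg0 ?addn0 //.
by apply/setP=> e; rewrite in_set0 (negPf (no_thrice e)).
Qed.

Lemma U_inj x y z a a' : a \in U -> a' \in U -> joins a x y -> joins a' x z ->
  a = a' /\ y = z.
Proof.
move=> aU aU' Ja Ja'; have E' : a = a'.
  exact: deg_le1_inj (degU_le1 x) aU aU' (joins_gt0 Ja) (joins_gt0 Ja').
by split=> //; apply: joins_other Ja _; rewrite E'.
Qed.

Lemma B_joins_inj x y z b b' : b \in B -> b' \in B -> joins b x y -> joins b' x z ->
  b = b' /\ y = z.
Proof.
move=> bB bB' Jb Jb'; have E' := B_inj bB bB' (joins_gt0 Jb) (joins_gt0 Jb').
by split=> //; apply: joins_other Jb _; rewrite E'.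
Qed.

Lemma joins_edge_neq e e' x y z w : joins e x y -> joins e' z w ->
  x != z -> x != w -> e != e'.
Proof.
move=> J J' xz xw; apply/eqP=> ee.
have := joins_gt0 J; rewrite ee => /(joins_end J')[] /eqP.
  by rewrite (negPf xz).
by rewrite (negPf xw).
Qed.

Lemma no_digon x y a b : a \in U -> b \in B -> joins a x y -> joins b x y -> False.
Proof.
move=> aU bB Ja Jb; have [j [j3 bM _]] := common_matching bB bB.
apply: (@no_switch j [:: a] [:: b]); rewrite /= ?aU ?bB ?bM //.
by move=> z; rewrite !big_seq1 Ja Jb.
Qed.

Lemma no_square x y z w a b a' b' : a \in U -> a' \in U -> b \in B -> b' \in B ->
  a != a' -> b != b' ->
  joins a x y -> joins b y z -> joins a' z w -> joins b' w x -> False.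
Proof.
move=> aU aU' bB bB' aa bb Ja Jb Ja' Jb'.
have [j [j3 bM bM']] := common_matching bB bB'.
apply: (@no_switch j [:: a; a'] [:: b; b']);
  rewrite /= ?mem_seq1 ?aa ?bb ?aU ?aU' ?bB ?bB' ?bM ?bM' //.
by move=> v; rewrite !big_cons !big_nil Ja Jb Ja' Jb'; clear; lia.
Qed.

Lemma missing_matching b : b \in B ->
  exists2 m, m < 3 & forall j, j < 3 -> (b \in M j) = (j != m).
Proof.
move: (no_thrice b); rewrite !inE /cover_count.
case b0 : (b \in M 0); case b1 : (b \in M 1); case b2 : (b \in M 2) => // _ _.
- by exists 2 => // [[|[|[|//]]]]; rewrite ?b0 ?b1 ?b2.
- by exists 1 => // [[|[|[|//]]]]; rewrite ?b0 ?b1 ?b2.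
- by exists 0 => // [[|[|[|//]]]]; rewrite ?b0 ?b1 ?b2.
Qed.

Lemma cover_of_triple : ~ three_edge_colourable s t -> short_cover s t.
Proof.
move=> uncolourable.
(* An alternating path v5 v0 v1 v2 v3 v4 is traced from one uncovered edge; [a] names uncovered and
   [b] doubly covered edges, indexed by their ends. *)
have [a12 a12U] : exists a, a \in U by apply/card_gt0P; rewrite cardU.
have := joins_ends s t a12; set v1 := s a12; set v2 := t a12 => J12.
have [b01 [v0 [b01B J10]]] := B_at_U a12U (joins_gt0 J12).
have [b23 [v3 [b23B J23]]] := B_at_U a12U (joins_gt0 (joinsC J12)).
have [a50 [v5 [a50U J05]]] := U_at_B b01B (joins_gt0 (joinsC J10)).
have [a34 [v4 [a34U J34]]] := U_at_B b23B (joins_gt0 (joinsC J23)).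
have J01 := joinsC J10.
have n12 := joins_neq J12; have n01 := joins_neq J01; have n23 := joins_neq J23.
have n05 := joins_neq J05; have n34 := joins_neq J34.
have n02 : v0 != v2.
  apply/eqP=> E'; apply: (no_digon a12U b01B J12).
  by rewrite -E'.
have n03 : v0 != v3.
  apply/eqP=> E'; have J32 : joins b23 v0 v2 by rewrite E'; apply: joinsC.
  by have [_ /eqP] := B_joins_inj b01B b23B J01 J32; rewrite (negPf n12).
have n13 : v1 != v3.
  apply/eqP=> E'; have J32 : joins b23 v1 v2 by rewrite E'; apply: joinsC.
  by have [_ /eqP] := B_joins_inj b01B b23B J10 J32; rewrite (negPf n02).
have ab : b01 != b23 by apply: joins_edge_neq J01 J23 _ _.
have n14 : v1 != v4.
  apply/eqP=> E'; have J' : joins a34 v1 v3 by rewrite E'; apply: joinsC.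
  by have [_ /eqP] := U_inj a12U a34U J12 J'; rewrite (negPf n23).
have n24 : v2 != v4.
  apply/eqP=> E'; have J' : joins a34 v2 v3 by rewrite E'; apply: joinsC.
  by have [_ /eqP] := U_inj a12U a34U (joinsC J12) J'; rewrite (negPf n13).
have aa1 : a12 != a34.
  by rewrite eq_sym; apply: joins_edge_neq J34 J12 _ _; rewrite eq_sym.
have n04 : v0 != v4.
  apply/eqP=> E'; apply: (no_square a12U a34U b23B b01B aa1 _ J12 J23 J34).
    by rewrite eq_sym.
  by rewrite -E'.
have n15 : v1 != v5.
  apply/eqP=> E'; have J' : joins a50 v1 v0 by rewrite E'; apply: joinsC.
  by have [_ /eqP] := U_inj a12U a50U J12 J'; rewrite eq_sym (negPf n02).
have n25 : v2 != v5.
  apply/eqP=> E'; have J' : joins a50 v2 v0 by rewrite E'; apply: joinsC.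
  by have [_ /eqP] := U_inj a12U a50U (joinsC J12) J'; rewrite eq_sym (negPf n01).
have n35 : v3 != v5.
  apply/eqP=> E'; have J' : joins a50 v3 v0 by rewrite E'; apply: joinsC.
  by have [_ /eqP] := U_inj a34U a50U J34 J'; rewrite eq_sym (negPf n04).
have n45 : v4 != v5.
  apply/eqP=> E'; have J' : joins a50 v4 v0 by rewrite E'; apply: joinsC.
  by have [_ /eqP] := U_inj a34U a50U (joinsC J34) J'; rewrite eq_sym (negPf n03).
have aa2 : a12 != a50 by rewrite eq_sym; apply: joins_edge_neq J05 J12 _ _.
have aa3 : a34 != a50 by apply: joins_edge_neq J34 J05 _ _; rewrite // eq_sym.
have UE : U = [set a12; a34; a50].
  apply/esym/eqP; rewrite eqEcard cardU; apply/andP; split.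
    by apply/subsetP=> e; rewrite !in_setU !in_set1 -orbA => /or3P[] /eqP->.
  by rewrite -setUA cardsU1 cards2 !inE (negPf aa1) (negPf aa2) aa3.
have [b45 [w [b45B J4w]]] := B_at_U a34U (joins_gt0 (joinsC J34)).
(* [w] meets an uncovered edge, so it is one of the six vertices; [v0] to [v3] already have another
   doubly covered edge. *)
have w5 : w = v5.
  have [u [w' [uU Ju]]] := U_at_B b45B (joins_gt0 (joinsC J4w)).
  have n4w := joins_neq J4w.
  have uw := joins_gt0 Ju.
  have : [\/ w = v0, w = v1, w = v2 | w = v3] \/ w = v4 \/ w = v5.
    move: uU uw; rewrite UE !inE -orbA => /or3P[] /eqP->.
    - by move=> /(joins_end J12)[]->; left; [constructor 2|constructor 3].
    - by move=> /(joins_end J34)[]->; [left; constructor 4|right; left].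
    - by move=> /(joins_end J05)[]->; [left; constructor 1|right; right].
  have Jw4 := joinsC J4w.
  case=> [[] E'|[E'|//]]; rewrite E' in Jw4 n4w.
  - by have [_ /eqP] := B_joins_inj b01B b45B J01 Jw4; rewrite (negPf n14).
  - by have [_ /eqP] := B_joins_inj b01B b45B J10 Jw4; rewrite (negPf n04).
  - by have [_ /eqP] := B_joins_inj b23B b45B J23 Jw4; rewrite (negPf n34).
  - by have [_ /eqP] := B_joins_inj b23B b45B (joinsC J23) Jw4; rewrite (negPf n24).
  - by rewrite eqxx in n4w.
rewrite {w}w5 in J4w.
have bb2 : b01 != b45 by apply: joins_edge_neq J01 J4w _ _.
have bb3 : b23 != b45 by apply: joins_edge_neq J23 J4w _ _.
pose vs := [:: v0; v1; v2; v3; v4; v5].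
pose hs := [:: b01; a12; b23; a34; b45; a50].
have uvs : uniq vs.
  by rewrite /= !inE !negb_or n01 n02 n03 n04 n05 n12 n13 n14 n15 n23 n24 n25 n34 n35 n45.
have UB a b : a \in U -> b \in B -> a != b.
  by move=> aU bB; apply: contraTneq aU => ->; move: bB; rewrite !inE; case: cover_count.
have uhs : uniq hs.
  rewrite /= !inE !negb_or ab bb2 bb3 aa1 aa2 aa3.
  rewrite !(UB a12) // (UB a34) // !(eq_sym _ a12) !(eq_sym _ a34) !(eq_sym _ a50).
  by rewrite !(UB a12) // !(UB a34) // !(UB a50).
have hex k : k < 6 -> joins (nth b01 hs k) (nth v0 vs k) (nth v0 vs (k.+1 %% 6)).
  case: k => [|[|[|[|[|[|//]]]]]] _.
  - exact: J01.
  - exact: J12.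
  - exact: J23.
  - exact: J34.
  - exact: J4w.
  exact: joinsC J05.
have [m0 m03 M0] := missing_matching b01B.
have [m1 m13 M1] := missing_matching b23B.
have [m2 m23 M2] := missing_matching b45B.
(* If two indices agreed, some matching would contain all three doubly covered edges, and switching
   it around the hexagon would contradict minimality. *)
have distinct_m : uniq [:: m0; m1; m2].
  case: (boolP (uniq _)) => // same.
  have [j [j3 j0 j1 j2]] : exists j, [/\ j < 3, j != m0, j != m1 & j != m2].
    move: same m03 m13 m23; rewrite /= !inE; clear.
    case: m0 => [|[|[|//]]]; case: m1 => [|[|[|//]]]; case: m2 => [|[|[|//]]] // _ _ _ _;
      by [exists 0|exists 1|exists 2].
  case: (@no_switch j [:: a12; a34; a50] [:: b01; b23; b45]);
    rewrite /= ?in_cons ?in_nil ?orbF ?negb_or ?aa1 ?aa2 ?aa3 ?ab ?bb2 ?bb3 ?M0 ?M1 ?M2 ?j0 ?j1 ?j2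
      ?a12U ?a34U ?a50U ?b01B ?b23B ?b45B //.
  by move=> z; rewrite !big_cons !big_nil J12 J34 J05 J01 J23 J4w; clear; lia.
(* The matchings are renumbered so that [N j] is the one missing the hexagon edge of index
   [j.*2]. *)
pose N i := M (nth 0 [:: m0; m1; m2] i).
have N3 i : i < 3 -> nth 0 [:: m0; m1; m2] i < 3 by case: i => [|[|[|]]].
have NP : matchings N by move=> i x i3; apply: PM; apply: N3.
have Ncount e : cover_count N e = cover_count M e.
  move: distinct_m m03 m13 m23; rewrite /cover_count /N /= !inE; clear.
  case: m0 => [|[|[|//]]]; case: m1 => [|[|[|//]]]; case: m2 => [|[|[|//]]] // _ _ _ _ /=;
    by case: (e \in M 0); case: (e \in M 1); case: (e \in M 2).
have out e : e \notin hs -> cover_count N e = 1.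
  move=> eh; rewrite Ncount.
  have eU : e \notin U.
    by apply: contra eh; rewrite UE !inE => /orP[/orP[]|] ->; rewrite ?orbT.
  (* An end of a doubly covered edge meets an uncovered one, hence is a hexagon vertex, whose only
     doubly covered edge is on the hexagon. *)
  have eB : e \notin B.
    apply: contra eh => eB; have Je := joins_ends s t e.
    have [u [y [uU Ju]]] := U_at_B eB (joins_gt0 Je).
    have ins (b : E) x y' : b \in hs -> b \in B -> joins b x y' -> s e = x -> e \in hs.
      move=> bh bB Jb E'; rewrite E' in Je.
      by have [-> _] := B_joins_inj eB bB Je Jb.
    move: uU (joins_gt0 Ju); rewrite UE !in_setU !in_set1 -orbA => /or3P[] /eqP->.
    - by move=> /(joins_end J12)[];
        [apply: (ins _ _ _ _ _ J10)|apply: (ins _ _ _ _ _ J23)] => //;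
        rewrite !inE eqxx ?orbT.
    - by move=> /(joins_end J34)[];
        [apply: (ins _ _ _ _ _ (joinsC J23))|apply: (ins _ _ _ _ _ J4w)] => //;
        rewrite !inE eqxx ?orbT.
    - by move=> /(joins_end J05)[];
        [apply: (ins _ _ _ _ _ J01)|apply: (ins _ _ _ _ _ (joinsC J4w))] => //;
        rewrite !inE eqxx ?orbT.
  by move: eU eB; rewrite !inE; case: (cover_count M e) => [|[|]].
have UN a i : a \in U -> i < 3 -> (a \in N i) = false.
  move=> aU /N3; rewrite /N; move: aU; rewrite inE /cover_count.
  by case: (nth _ _ i) => [|[|[|//]]]; do 3!case: (a \in _).
have Nh j k : j < 3 -> k < 6 -> (nth b01 hs k \in N j) = ~~ odd k && (k != j.*2).
  move: distinct_m; rewrite /= !inE !negb_or !andbT => /andP[/andP[m01 m02] m12] j3.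
  have m10 : m1 != m0 by rewrite eq_sym.
  have m20 : m2 != m0 by rewrite eq_sym.
  have m21 : m2 != m1 by rewrite eq_sym.
  case: k => [|[|[|[|[|[|//]]]]]] _; try exact: UN.
  - by rewrite /N M0 ?N3 //; case: j j3 => [|[|[|//]]] _; rewrite /= ?eqxx.
  - by rewrite /N M1 ?N3 //; case: j j3 => [|[|[|//]]] _; rewrite /= ?eqxx.
  by rewrite /N M2 ?N3 //; case: j j3 => [|[|[|//]]] _; rewrite /= ?eqxx.
have [c cP] := @colouring_of_matchings _ _ s t v0 b01 vs hs erefl erefl uvs uhs hex N NP out Nh.
apply: (@hexagon_short_cover _ _ s t v0 b01 vs hs) cP => //.
Qed.

End MatchingTriples.

(** * The defect as an attained minimum, and the conclusion *)

(** The first alternative accounts for the default value of the minimum. *)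
Lemma colouring_defect_attained (V E : finType) (s t : E -> V) :
  colouring_defect s t = #|E| \/
  exists2 A, three_array s t A & #|uncovered A| = colouring_defect s t.
Proof.
rewrite /colouring_defect.
elim/big_rec: _ => [|A d AP IH]; first by left.
by rewrite /minn; case: ifP => _ //; right; exists A.
Qed.

Lemma colouring_defect_le (V E : finType) (s t : E -> V) A :
  three_array s t A -> colouring_defect s t <= #|uncovered A|.
Proof.
rewrite /colouring_defect => AP; have : A \in index_enum _ := mem_index_enum A.
elim: (index_enum _) => // A' r IH; rewrite inE big_cons => /predU1P[<-|/IH le].
  by rewrite AP geq_minl.
by case: ifP => // _; apply: leq_trans (geq_minr _ _) le.
Qed.

Lemma perfect_matchingP (V E : finType) (s t : E -> V) M :
  reflect (forall x, deg s t M x = 1) (perfect_matching s t M).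
Proof. exact: 'forall_eqP. Qed.

Lemma uncovered_triple (E : finType) (M : nat -> {set E}) :
  uncovered (M 0, M 1, M 2) = uncovered_by M.
Proof.
apply/setP=> e; rewrite !inE /cover_count.
by do 3!case: (e \in _).
Qed.

(* With three edges the default value of [colouring_defect] could be the value 3. *)
Lemma three_edges_defect (V E : finType) (s t : E -> V) :
  connected_graph s t -> cubic s t -> #|E| = 3 -> colouring_defect s t <= 2.
Proof.
move=> conn cub E3; have := card_edges cub; rewrite E3 => V2.
have /cards2P[x [y [xy VE]]] : #|[set: V]| == 2.
  by rewrite cardsT; move: V2; clear; lia.
have [e Je] : exists e, joins s t e x y.
  case: (boolP [exists e, (0 < inc s t e x) && (0 < inc s t e y)]) => [/existsP[e /andP[ex ey]]|no].
    exists e; have [z Jz] := inc_joins ex.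
    by case: (joins_end Jz ey) => [yx|->//]; rewrite yx eqxx in xy.
  have closedx : closed (adj s t) (pred1 x).
    have all2 w : w != x -> w = y.
      by have := in_setT w; rewrite VE !inE => /orP[] /eqP-> //; rewrite eqxx.
    move=> u w /existsP[d dP].
    have [du dw] : 0 < inc s t d u /\ 0 < inc s t d w.
      by move: dP; rewrite /Defs.inc => /orP[] /andP[/eqP-> /eqP->];
        rewrite !eqxx ?addn1.
    have nd : ~ (0 < inc s t d x /\ 0 < inc s t d y).
      by move=> [dx dy]; case/negP: no; apply/existsP; exists d; rewrite dx.
    rewrite !inE; case: (eqVneq u x) du => [->|/all2 ->] du;
      case: (eqVneq w x) dw => [->|/all2 ->] dw //; by case: nd.
  by have := closed_connect closedx (conn x y); rewrite !inE eqxx eq_sym (negPf xy).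
(* Taken three times, this matching leaves two of the three edges uncovered. *)
have PMe : perfect_matching s t [set e].
  apply/perfect_matchingP => z; rewrite deg1 Je.
  have := in_setT z; rewrite VE !inE => /orP[] /eqP->; rewrite eqxx.
    by rewrite (negPf xy).
  by rewrite eq_sym (negPf xy).
have AP : three_array s t ([set e], [set e], [set e]) by rewrite /three_array /= PMe.
apply: leq_trans (colouring_defect_le AP) _.
rewrite /uncovered /= !setUid; have := cardsC [set e]; rewrite cards1 E3.
by clear; lia.
Qed.

(* length <= 4m/3 + 1  <=>  3 * length <= 4m + 3 *)
Theorem theorem7p2 (V E : finType) (s t : E -> V) :
  snark s t -> colouring_defect s t = 3 ->
  exists cs : seq {set E},
    cycle_cover s t cs /\ 3 * cover_length cs <= 4 * #|E| + 3.
Proof.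
move=> [G2 [cubicG uncolourable]] df3.
(* If the defect were the default value, there would be three edges, and it would be at most 2. *)
have [df|[[[M0 M1] M2] AP dfA]] := colouring_defect_attained s t.
  have := three_edges_defect (proj1 G2) cubicG (etrans (esym df) df3).
  by rewrite df3.
pose M i := nth set0 [:: M0; M1; M2] i.
have /and3P[/perfect_matchingP P0 /perfect_matchingP P1 /perfect_matchingP P2] := AP.
apply: (@cover_of_triple _ _ s t M) => //.
- by case=> [|[|[|]]].
- by rewrite -uncovered_triple -df3 -dfA.
move=> M' M'P; rewrite -uncovered_triple -df3; apply: colouring_defect_le.
by apply/and3P; split; apply/perfect_matchingP => x; apply: M'P.
Qed.
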